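(* For every admissible algebra $\mathcal N$ and every $\pi\in\Pi(\mathcal N)$ there exists a subgroup of $\mathrm{Aff}(S_\pi)$ acting transitively on $S_\pi\cap\mathcal N_{[4]}$. In particular, $\mathcal N$ has Property (AH) if $\mathcal N$ has nil-index $\le4$.
   Context: $\mathbb F$ is a field of characteristic $0$; all algebras are associative $\mathbb F$-algebras. For an algebra $\mathcal N$ put $\mathcal N^1=\mathcal N$ and let $\mathcal N^{k+1}$ be the linear span of $\mathcal N\mathcal N^k$; $\mathcal N$ is nilpotent if $\mathcal N^{k+1}=0$ for some $k\ge0$, and the minimal such $k$ is the nil-index. For commutative $\mathcal N$ and $k>0$ put $\mathcal N_{[k]}:=\{x\in\mathcal N:x\mathcal N^k=0\}$; $\mathcal N_{[1]}$ is the annihilator. An admissible algebra is a commutative nilpotent algebra of finite dimension over $\mathbb F$ with $\dim\mathcal N_{[1]}=1$. $\Pi(\mathcal N)$ is the set of all linear maps $\pi=\pi^2\in\mathrm{End}(\mathcal N)$ with range $\mathcal N_{[1]}$. Put $\exp_1(x)=\sum_{k\ge1}x^k/k!$ for $x\in\mathcal N$ and $S_\pi:=\{x\in\mathcal N:\pi(\exp_1x)=0\}$. $\mathrm{Aff}(S_\pi)$ is the group of all affine bijections $g$ of $\mathcal N$ with $g(S_\pi)=S_\pi$. $\mathcal N$ has Property (AH) if for some (equivalently, every) $\pi\in\Pi(\mathcal N)$ the hypersurface $S_\pi$ is affinely homogeneous, i.e. $\mathrm{Aff}(S_\pi)$ acts transitively on $S_\pi$. *)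

(* Defs.v *)
From HB Require Import structures.
From mathcomp Require Import all_boot all_algebra.
From mathcomp Require Import classical_sets.

Set Implicit Arguments.
Unset Strict Implicit.
Unset Printing Implicit Defensive.

Import GRing.Theory.

Local Open Scope ring_scope.

(* Finite-dimensional associative algebras, not assumed to have a unit:
   nilpotent algebras have none, so the MathComp rings do not apply. *)
HB.mixin Record isAssocAlgebra (F : fieldType) V of Vector F V := {
  amul : V -> V -> V;
  amulA : associative amul;
  amul_linearr : forall x, linear (amul x);
  amul_linearl : forall y, linear (amul^~ y)
}.

#[short(type="assocAlgType")]
HB.structure Definition AssocAlgebra (F : fieldType) :=
  {V of isAssocAlgebra F V & Vector F V}.

Declare Scope assoc_alg_scope.
Delimit Scope assoc_alg_scope with AA.
Local Open Scope assoc_alg_scope.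

Notation "x ** y" := (amul x y) (at level 40, left associativity) :
  assoc_alg_scope.

Section AssocAlgebraTheory.

Variables (F : fieldType) (N : assocAlgType F).
Implicit Types (x y z : N) (U V W : {vspace N}).

Definition amulr y x := x ** y.

HB.instance Definition _ x :=
  GRing.isLinear.Build F N N *:%R (amul x) (amul_linearr x).
HB.instance Definition _ y :=
  GRing.isLinear.Build F N N *:%R (amulr y) (amul_linearl y).

Lemma amul_sumr I r (P : pred I) (E : I -> N) x :
  x ** (\sum_(i <- r | P i) E i) = \sum_(i <- r | P i) x ** E i.
Proof. exact: (linear_sum (amul x)). Qed.

Lemma amul_suml I r (P : pred I) (E : I -> N) y :
  (\sum_(i <- r | P i) E i) ** y = \sum_(i <- r | P i) E i ** y.
Proof. exact: (linear_sum (amulr y)). Qed.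

Lemma amulZr a x y : x ** (a *: y) = a *: (x ** y).
Proof. exact: (linearZZ (amul x)). Qed.

Lemma amulZl a x y : (a *: x) ** y = a *: (x ** y).
Proof. exact: (linearZZ (amulr y)). Qed.

(* The linear span of the products u ** v, for u in U and v in V; by
   bilinearity bases suffice (see aprodvP). *)
Definition aprodv U V : {vspace N} :=
  <<[seq u ** v | u <- vbasis U, v <- vbasis V]>>%VS.

Lemma memv_amul U V : {in U & V, forall u v, u ** v \in aprodv U V}.
Proof.
move=> u v /coord_vbasis-> /coord_vbasis->.
rewrite amul_suml; apply: memv_suml => i _.
rewrite amul_sumr; apply: memv_suml => j _.
rewrite amulZl amulZr !memvZ // memv_span //.
by apply/allpairsP; exists ((vbasis U)`_i, (vbasis V)`_j); rewrite !memt_nth.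
Qed.

Lemma aprodvP U V W :
  reflect {in U & V, forall u v, u ** v \in W} (aprodv U V <= W)%VS.
Proof.
apply: (iffP idP) => [sUVW u v Uu Vv | sUVW].
  by rewrite (subvP sUVW) ?memv_amul.
apply/span_subvP => _ /allpairsP[[u v] /= [Uu Vv ->]].
by rewrite sUVW ?vbasis_mem.
Qed.

(* npow k is the k-th power N^k, for k >= 1 (npow 0 is junk). *)
Definition npow k : {vspace N} := iter k.-1 (aprodv fullv) fullv.

Definition nilpotent_algebra := exists k, npow k.+1 = 0%VS.

Definition is_nil_index k :=
  npow k.+1 = 0%VS /\ (forall j, npow j.+1 = 0%VS -> (k <= j)%N).

(* The subspace N_[k] of all x such that x N^k = 0, for k >= 1
   (see memv_nann). *)
Definition nann k : {vspace N} :=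
  (\bigcap_i lker (linfun (amulr (tnth (vbasis (npow k)) i))))%VS.

Lemma memv_nann k x :
  x \in nann k <-> (forall y, y \in npow k -> x ** y = 0).
Proof.
rewrite memvE; split=> [/subv_bigcapP xN y /coord_vbasis-> | xN].
  rewrite amul_sumr big1 // => i _; rewrite amulZr.
  have := xN i isT; rewrite -memvE memv_ker lfunE /= (tnth_nth 0) => /eqP.
  by rewrite /amulr => ->; rewrite scaler0.
apply/subv_bigcapP => i _; rewrite -memvE memv_ker lfunE /=.
by apply/eqP/xN/vbasis_mem/mem_tnth.
Qed.

Definition admissible :=
  [/\ commutative (@amul F N), nilpotent_algebra & \dim (nann 1) = 1%N].

Definition is_Pi (p : 'End(N)) := (p \o p)%VF = p /\ limg p = nann 1.

(* x^k, for k >= 1 (apow x 0 is junk). *)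
Definition apow x k : N := iter k.-1 (amul x) x.

(* The terms of the exponential series vanish beyond \dim N when N is
   nilpotent, so truncating there loses nothing (see exp1E). *)
Definition exp1 x : N :=
  \sum_(1 <= k < (\dim {:N}).+1) (k`!)%:R^-1 *: apow x k.

Definition hypersurface (p : 'End(N)) : set N := [set x | p (exp1 x) = 0]%classic.

Lemma apow_npow x k : apow x k \in npow k.
Proof.
rewrite /apow /npow; elim: k.-1 => [|n IHn] /=; first exact: memvf.
by rewrite memv_amul ?memvf.
Qed.

Lemma npowS k : npow k.+2 = aprodv fullv (npow k.+1).
Proof. by []. Qed.

Lemma npow_subS k : (npow k.+2 <= npow k.+1)%VS.
Proof.
elim: k => [|k IHk]; first exact: subvf.
rewrite npowS; apply/aprodvP => u v Nu kv.
by rewrite npowS memv_amul ?(subvP IHk).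
Qed.

Lemma npow_sub j k : (j <= k)%N -> (npow k.+1 <= npow j.+1)%VS.
Proof.
move=> /subnK <-; elim: (k - j)%N => [|n IHn]; first by rewrite add0n.
exact: subv_trans (npow_subS _) IHn.
Qed.

Lemma npow_dim : nilpotent_algebra -> npow (\dim {:N}).+1 = 0%VS.
Proof.
move=> [m m0].
have stat k : npow k.+2 = npow k.+1 -> npow k.+1 = 0%VS.
  move=> eqk; suff e n : npow (n + k).+1 = npow k.+1.
    by apply/eqP; rewrite -subv0 -(e m) -m0 npow_sub ?leq_addr.
  by elim: n => // n IHn; rewrite addSn npowS IHn -npowS.
have dec k : npow k.+1 = 0%VS \/ (\dim (npow k.+1) + k <= \dim {:N})%N.
  elim: k => [|k [k0|IHk]]; first by right; rewrite addn0.
    by left; apply/eqP; rewrite -subv0 -k0 npow_subS.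
  have [eqk|neqk] := eqVneq (npow k.+2) (npow k.+1).
    by left; rewrite eqk stat.
  right; rewrite addnS -addSn; apply: leq_trans IHk; rewrite leq_add2r.
  by move: neqk; rewrite eqEdim npow_subS -ltnNge.
case: (dec (\dim {:N})) => // le_d; apply/eqP.
by rewrite -dimv_eq0 -leqn0 -(leq_add2r (\dim {:N})) add0n.
Qed.

Lemma exp1E x n : nilpotent_algebra -> (\dim {:N} <= n)%N ->
  exp1 x = \sum_(1 <= k < n.+1) (k`!)%:R^-1 *: apow x k.
Proof.
move=> nilN le_dn; rewrite (@big_cat_nat _ _ _ (\dim {:N}).+1) //=.
rewrite [X in _ + X]big_nat_cond [X in _ + X]big1 ?addr0 // => k.
rewrite andbT => /andP[lt_dk _]; have := apow_npow x k.
case: k lt_dk => // k le_dk /(subvP (@npow_sub (\dim {:N}) k le_dk)).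
by rewrite npow_dim // memv0 => /eqP->; rewrite scaler0.
Qed.

End AssocAlgebraTheory.

Section AffineMaps.

Variables (F : fieldType) (V : vectType F).
Local Open Scope classical_set_scope.
Implicit Types (S A : set V) (H : set (V -> V)) (g : V -> V).

Definition affine_bijection g :=
  bijective g /\ exists (f : 'End(V)) (b : V), forall x, g x = f x + b.

Definition Aff S : set (V -> V) :=
  [set g | affine_bijection g /\ g @` S = S].

(* H is a subgroup of the group of all affine bijections preserving S. *)
Definition subgroup_Aff S H :=
  [/\ H `<=` Aff S, H id,
      forall g h, H g -> H h -> H (g \o h)
    & forall g, H g -> exists h, [/\ H h, cancel g h & cancel h g]].

Definition acts_transitively H A :=
  (forall g, H g -> g @` A = A) /\
  (forall x y, A x -> A y -> exists2 g, H g & g x = y).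

Definition affinely_homogeneous S := acts_transitively (Aff S) S.

End AffineMaps.

(* "For some" and "for every" projection are equivalent for admissible
   algebras; both are required, so that the definition does not rely on it. *)
Definition property_AH (F : fieldType) (N : assocAlgType F) :=
  (exists2 p, is_Pi p & affinely_homogeneous (hypersurface (N := N) p)) /\
  (forall p, is_Pi p -> affinely_homogeneous (hypersurface (N := N) p)).

(* Main.v *)
Require Import Defs.
From HB Require Import structures.
From mathcomp Require Import all_boot all_algebra.
From mathcomp Require Import classical_sets.
From mathcomp Require Import ring.

Import GRing.Theory.

Local Open Scope ring_scope.

(** For a point y of S_pi in N_[4], the translate S_pi - y is the zero set of
    pi(exp(y) exp_1(z)), so it suffices to find a linear bijection L such that
    pi(exp(y) (L z)^k) = pi(z^k) for all k >= 1; then z |-> y + L z maps S_pi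
    to itself and 0 to y. Since y N^4 = 0, only finitely many correction terms
    matter. Multiplication by exp(-y/2) satisfies the condition for k = 2 and
    for k >= 4, and k = 1 can be restored by adding a term with values in
    N_[1], which no other power sees. For k = 3 there remains the defect
    -pi(y z^3)/2. It is removed by first applying
    z |-> z + y Q z / 6 + w z, where Q is a projection with kernel
    N^2 + N_[2], and where w, built from the adjoint of Q for the form pi(x y),
    takes values in N_[2] and makes this map an isometry for pi(z^2). All
    denominators disappear on writing y = 12 t. *)

(** * The unital hull of N: a commutative ring containing N *)

Section Unitization.
Set Implicit Arguments.
Unset Strict Implicit.
Local Open Scope assoc_alg_scope.
Variables (F : fieldType) (N : assocAlgType F).

(* The type carries the proof of commutativity so that it can be a
   commutative ring, on which [ring] works. *)
Definition unitization of commutative (@amul F N) := (F * N)%type.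

Variable comN : commutative (@amul F N).
Local Notation A := (unitization comN).

HB.instance Definition _ := GRing.Zmodule.copy A (F * N)%type.

Definition unitization_one : A := (1, 0).
Definition unitization_mul (a b : A) : A :=
  (a.1 * b.1, a.1 *: b.2 + b.1 *: a.2 + a.2 ** b.2).

Lemma amulDr (x y z : N) : x ** (y + z) = x ** y + x ** z.
Proof. exact: (linearD (amul x)). Qed.
Lemma amulDl (x y z : N) : (x + y) ** z = x ** z + y ** z.
Proof. exact: (linearD (amulr z)). Qed.
Lemma amulr0 (x : N) : x ** 0 = 0.
Proof. exact: (linear0 (amul x)). Qed.
Lemma amul0r (x : N) : 0 ** x = 0.
Proof. exact: (linear0 (amulr x)). Qed.

Fact unitization_mulC : commutative unitization_mul.
Proof.
move=> a b; rewrite /unitization_mul mulrC (comN b.2).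
by rewrite (addrC (b.1 *: _)).
Qed.

Fact unitization_mul1 : left_id unitization_one unitization_mul.
Proof.
move=> [b y]; congr (_, _); rewrite /= ?mul1r //.
by rewrite scale1r scaler0 amul0r !addr0.
Qed.

Fact unitization_mulDl : left_distributive unitization_mul +%R.
Proof.
move=> [a x] [b y] [c z]; congr (_, _) => /=; first by rewrite mulrDl.
by rewrite scalerDl scalerDr amulDl !addrA [LHS](ACl (1*3*5*2*4*6))%AC.
Qed.

Fact unitization_mulA : associative unitization_mul.
Proof.
move=> [a x] [b y] [c z]; congr (_, _) => /=; first by rewrite mulrA.
rewrite !scalerDr !amulDr !amulDl !amulZr !amulZl amulA !scalerA.
by rewrite (mulrC c a) (mulrC c b) !addrA [LHS](ACl (1*2*4*6*3*5*7))%AC.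
Qed.

Fact unitization_one_neq0 : unitization_one != 0.
Proof. by apply/eqP => -[/eqP]; rewrite oner_eq0. Qed.

HB.instance Definition _ := GRing.Zmodule_isComNzRing.Build A
  unitization_mulA unitization_mulC unitization_mul1 unitization_mulDl
  unitization_one_neq0.

Definition unitize (x : N) : A := (0, x).

Fact unitize_is_zmod_morphism : zmod_morphism unitize.
Proof. by move=> x y; congr (_, _); rewrite /= subr0. Qed.
HB.instance Definition _ :=
  GRing.isZmodMorphism.Build N A unitize unitize_is_zmod_morphism.

Lemma unitize_inj : injective unitize.
Proof. by move=> x y []. Qed.

Lemma unitizeD x y : unitize (x + y) = unitize x + unitize y.
Proof. exact: raddfD. Qed.
Lemma unitizeN x : unitize (- x) = - unitize x.
Proof. exact: raddfN. Qed.
Lemma unitizeMn x n : unitize (x *+ n) = unitize x *+ n.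
Proof. exact: raddfMn. Qed.
Lemma unitize0 : unitize 0 = 0.
Proof. exact: raddf0. Qed.

Lemma unitizeM x y : unitize (x ** y) = unitize x * unitize y.
Proof. by congr (_, _); rewrite /= ?mul0r // !scale0r !add0r. Qed.

(** Only positive exponents agree: [apow x 0] is [x], whereas the zeroth power in the ring is 1. *)
Lemma unitize_apow x k : unitize (apow x k.+1) = unitize x ^+ k.+1.
Proof.
by elim: k => // k IHk; rewrite exprS -IHk -unitizeM.
Qed.
End Unitization.

(** * Polynomial identities involving an element t of N_[4] *)

Section Identities.
Set Implicit Arguments.
Unset Strict Implicit.
Local Open Scope assoc_alg_scope.
Variables (F : fieldType) (N : assocAlgType F).
Hypothesis charF : [pchar F] =i pred0.
Hypothesis comN : commutative (@amul F N).
Implicit Types (g h q s t w z : N).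

Lemma nann1P s a : s \in nann N 1 -> s ** a = 0.
Proof. by move/memv_nann; apply; apply: memvf. Qed.

Lemma nann2P w a b : w \in nann N 2 -> w ** (a ** b) = 0.
Proof. by move/memv_nann; apply; rewrite npowS memv_amul ?memvf. Qed.

Lemma nann4P t a b c d : t \in nann N 4 -> t ** (a ** (b ** (c ** d))) = 0.
Proof. by move/memv_nann; apply; rewrite !npowS !memv_amul ?memvf. Qed.

Local Notation u := (unitize comN).
Local Notation uE := (unitizeD comN, unitizeN comN, unitizeMn comN,
  unitize0 comN, unitizeM comN).

(** The annihilation rules are moved to the unitization, where [ring] can take them as hypotheses.
    The last one kills products of five factors of which one is t. *)
Let H1 s a : s \in nann N 1 -> u s * u a = 0.
Proof. by move=> hs; rewrite -unitizeM nann1P ?unitize0. Qed.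
Let H2 w a b : w \in nann N 2 -> u w * (u a * u b) = 0.
Proof. by move=> hw; rewrite -!unitizeM nann2P ?unitize0. Qed.
Let H4 t a b c d : t \in nann N 4 -> u t * (u a * (u b * (u c * u d))) = 0.
Proof. by move=> ht; rewrite -!unitizeM nann4P ?unitize0. Qed.

(** * Multiplication by exp(-6 t), followed by a correction s in the annihilator *)

Section Twist.
Variables t g s : N.
Hypotheses (ht : t \in nann N 4) (hs : s \in nann N 1).

(* The product of g with exp(-6 t), that is exp(-y/2), up to t^3 g. *)
Definition twist := g - (t ** g) *+ 6 + (t ** (t ** g)) *+ 18.

(** Since s N = 0, the term s, which will repair the linear condition, is invisible in the
    square. *)
Let absorb : u (twist + s) ^+ 2 = u twist ^+ 2.
Proof.
have S1 := H1 twist hs; have S2 := H1 s hs; rewrite unitizeD.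
move: S1 S2; move: (u twist) (u s) => a b S1 S2.
by ring: S1 S2.
Qed.

Let twistE : u twist = u g - (u t * u g) *+ 6 + (u t * (u t * u g)) *+ 18.
Proof. by rewrite /twist !uE. Qed.

(** Squaring exp(-6 t) gives the inverse of exp(12 t), and t^3 g^2 = 0 makes the truncations
    harmless. *)
Lemma twist_sqr : let h := twist + s in
  h ** h + (t ** (h ** h)) *+ 12 + (t ** (t ** (h ** h))) *+ 72 = g ** g.
Proof.
move: absorb; rewrite twistE; move: (twist + s) => h absorb'.
apply: (unitize_inj (comN := comN)); rewrite !uE -!expr2 absorb'.
have := H4 t t g g ht; move: (u t) (u g) => a b T.
by ring: T.
Qed.

(** Here exp(12 t) exp(-18 t) = exp(-6 t), of which only 1 - 6 t matters because t^2 g^3 = 0. The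
    term -6 t g^3 is the cubic defect. *)
Lemma twist_cube : let h := twist + s in
  h ** (h ** h) + (t ** (h ** (h ** h))) *+ 12
  = g ** (g ** g) - (t ** (g ** (g ** g))) *+ 6.
Proof.
have := unitizeD comN twist s; have := H1 twist hs; move: absorb.
rewrite twistE; move: (twist + s) => h absorb' S hE.
apply: (unitize_inj (comN := comN)); rewrite !uE -!expr2 absorb' hE.
move: S (H4 t g g g ht); move: (u t) (u g) (u s) => a b c S T.
rewrite mulrDl expr2 [c * _]mulrA S mul0r addr0.
by ring: T.
Qed.

Lemma twist_ge4 m : apow (twist + s) m.+4 = apow g m.+4.
Proof.
apply: (unitize_inj (comN := comN)); rewrite !unitize_apow.
rewrite -(addn4 m) (addnC m) 2!exprD (exprM _ 2 2) absorb.
have T := H4 g g g g ht.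
have -> : (u twist ^+ 2) ^+ 2 = u g ^+ 4.
  by rewrite twistE; move: (u t) (u g) T => a b T; ring: T.
have absorb1 : u g ^+ 4 * u (twist + s) = u g ^+ 4 * u g.
  rewrite unitizeD mulrDr [_ * u s]mulrC; have := H1 g hs; rewrite twistE.
  move: (u t) (u g) (u s) T => a b c T S.
  have -> : c * b ^+ 4 = 0 by ring: S.
  by ring: T.
elim: m => // m IHm.
by rewrite (exprS _ m) (exprS (u g) m) mulrA absorb1 -mulrA mulrCA IHm mulrCA.
Qed.

End Twist.

(** * Adding e = 2 t q + w, which cancels the cubic defect *)

Section Correction.
(* To be applied with q = Q z, so that e = y Q z / 6 + w z. *)
Variables t z q w e : N.
Hypotheses (ht : t \in nann N 4) (hw : w \in nann N 2).
Hypothesis e_def : e = (t ** q) *+ 2 + w.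

Let ue : u e = (u t * u q) *+ 2 + u w.
Proof. by rewrite e_def !uE. Qed.

Lemma correct_sqr : (z + e) ** (z + e) =
  z ** z + (q ** (t ** z + t ** (t ** q))) *+ 4 + (z ** w) *+ 2 + w ** w.
Proof.
apply: (unitize_inj (comN := comN)); rewrite !uE ue.
have := H2 t q hw; move: (u t) (u q) (u w) (u z) => a b c d W.
by ring: W.
Qed.

(** Each term of e e x is either a product of five factors containing t, or has a factor w
    multiplied by an element of N^2. *)
Let ee x : u e * (u e * u x) = 0.
Proof.
have := H2 q x hw; have := H2 w x hw; have := H4 t q q x ht; rewrite ue.
move: (u t) (u q) (u w) (u x) => a b c d T W1 W2.
have -> : ((a * b) *+ 2 + c) * (((a * b) *+ 2 + c) * d) =
  (a * (a * (b * (b * d)))) *+ 4 + (a * (c * (b * d))) *+ 4 + c * (c * d).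
  by ring.
by rewrite T W1 W2 mulr0 !mul0rn !addr0.
Qed.

(** As e e N = 0 and z z w = 0, the cube of g is z^3 + 6 t z^2 q = z^3 + 6 t z^3. Moreover t g^3 = t
    z^3, so the two multiples of t z^3 cancel. *)
Lemma correct_cube : t ** (z ** (z ** q)) = t ** (z ** (z ** z)) ->
  let g := z + e in
  g ** (g ** g) - (t ** (g ** (g ** g))) *+ 6 = z ** (z ** z).
Proof.
move=> /(congr1 u) hq; apply: (unitize_inj (comN := comN)).
move: hq; rewrite !uE => hq.
have E1 := ee z; have E2 := ee e.
have zze : u z * (u z * u e) = (u t * (u z * (u z * u q))) *+ 2.
  rewrite ue; have := H2 z z hw; move: (u t) (u q) (u w) (u z) => a b c d W.
  by ring: W.
have tzze : u t * (u z * (u z * u e)) = 0.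
  by rewrite zze mulrnAr (H4 t z z q ht) mul0rn.
have -> : (u z + u e) * ((u z + u e) * (u z + u e)) =
          u z * (u z * u z) + (u z * (u z * u e)) *+ 3.
  by move: (u z) (u e) E1 E2 => a b E1 E2; ring: E1 E2.
by rewrite mulrDr mulrnAr tzze mul0rn addr0 zze hq -mulrnA addrK.
Qed.

Lemma correct_ge4 m : apow (z + e) m.+4 = apow z m.+4.
Proof.
apply: (unitize_inj (comN := comN)); rewrite !unitize_apow unitizeD.
have E1 := ee z; have E2 := ee e.
have E3 : u e * u z ^+ 3 = 0.
  have := H4 q z z z ht; have := H2 z z hw; rewrite ue.
  move: (u t) (u q) (u w) (u z) => a b c d W T.
  have -> : ((a * b) *+ 2 + c) * d ^+ 3 =
    (a * (b * (d * (d * d)))) *+ 2 + c * (d * d) * d by ring.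
  by rewrite T W mul0rn mul0r addr0.
elim: m => [|m IHm].
  by move: (u e) (u z) E1 E2 E3 => a b E1 E2 E3; ring: E1 E2 E3.
rewrite exprS IHm mulrDl -exprS -(addn3 m.+1) (addnC m.+1) [in X in _ + X]exprD.
by rewrite mulrA E3 mul0r addr0.
Qed.

End Correction.

(** Group exp(12 t) exp(h) by degree in h. Products of five factors containing t vanish, so degrees
    1, 2, 3 keep powers of t up to 3, 2, 1, and from degree 4 on only the powers of h remain, which
    equal those of z. *)
Lemma exp1_shift t h z : nilpotent_algebra N -> t \in nann N 4 ->
  (forall m, apow h m.+4 = apow z m.+4) ->
  exp1 (t *+ 12 + h) = exp1 (t *+ 12) + exp1 z
    + (h + (t ** h) *+ 12 + (t ** (t ** h)) *+ 72
         + (t ** (t ** (t ** h))) *+ 288 - z)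
    + 2%:R^-1 *: (h ** h + (t ** (h ** h)) *+ 12
                  + (t ** (t ** (h ** h))) *+ 72 - z ** z)
    + 6%:R^-1 *: (h ** (h ** h) + (t ** (h ** (h ** h))) *+ 12
                  - z ** (z ** z)).
Proof.
(* Adding 4 lets the first four terms be split off whatever the dimension. *)
move=> nilN ht hz; pose n := (\dim {:N} + 4)%N.
have le_n : (\dim {:N} <= n)%N by rewrite leq_addr.
have T0 := H4 h h h h ht.
rewrite !(exp1E _ nilN le_n).
have tail x : \sum_(1 <= k < n.+1) (k`!)%:R^-1 *: apow x k =
    x + 2%:R^-1 *: (x ** x) + 6%:R^-1 *: (x ** (x ** x))
    + 24%:R^-1 *: (x ** (x ** (x ** x)))
    + \sum_(5 <= k < n.+1) (k`!)%:R^-1 *: apow x k.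
  by rewrite 4?big_ltn ?ltnS ?/n ?addn4 // !addrA invr1 scale1r.
rewrite !tail.
have T1 := H4 t t t t ht; have T2 := H4 t t t h ht; have T3 := H4 t t h h ht.
have T4 := H4 t h h h ht.
have -> : \sum_(5 <= k < n.+1) (k`!)%:R^-1 *: apow (t *+ 12 + h) k =
          \sum_(5 <= k < n.+1) (k`!)%:R^-1 *: apow z k.
  apply: eq_big_nat => -[|[|[|[|[|k]]]]] // _; congr (_ *: _).
  rewrite -hz; apply: (unitize_inj (comN := comN)); rewrite !unitize_apow.
  rewrite !uE; move: (u t) (u h) T0 T1 T2 T3 T4 => a b T0 T1 T2 T3 T4.
  elim: k => [|k IHk]; first by ring: T0 T1 T2 T3 T4.
  rewrite exprS IHk -[k.+4.+1]/(5 + k)%N exprD mulrA.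
  suff -> : (a *+ 12 + b) * b ^+ 5 = b ^+ 6 by rewrite -exprD.
  by ring: T0.
have -> : \sum_(5 <= k < n.+1) (k`!)%:R^-1 *: apow (t *+ 12) k = 0.
  rewrite big_nat big1 // => -[|[|[|[|[|k]]]]] // _.
  suff -> : apow (t *+ 12) k.+4.+1 = 0 by rewrite scaler0.
  apply: (unitize_inj (comN := comN)); rewrite !unitize_apow.
  rewrite -[k.+4.+1]/(5 + k)%N exprD; suff -> : u (t *+ 12) ^+ 5 = 0.
    by rewrite mul0r unitize0.
  by rewrite !uE; move: (u t) T1 => a T1; ring: T1.
have <- : h ** (h ** (h ** h)) = z ** (z ** (z ** z)) := hz 0%N.
have sqrE : (t *+ 12 + h) ** (t *+ 12 + h) =
    (t *+ 12) ** (t *+ 12) + ((t ** h) *+ 12) *+ 2 + h ** h.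
  by apply: (unitize_inj (comN := comN)); rewrite !uE; ring.
have cubE : (t *+ 12 + h) ** ((t *+ 12 + h) ** (t *+ 12 + h)) =
    (t *+ 12) ** ((t *+ 12) ** (t *+ 12))
    + ((t ** (t ** h)) *+ 72 + (t ** (h ** h)) *+ 6) *+ 6 + h ** (h ** h).
  by apply: (unitize_inj (comN := comN)); rewrite !uE; ring.
have quaE : (t *+ 12 + h) ** ((t *+ 12 + h) ** ((t *+ 12 + h) ** (t *+ 12 + h)))
    = (t *+ 12) ** ((t *+ 12) ** ((t *+ 12) ** (t *+ 12)))
    + ((t ** (t ** (t ** h))) *+ 288 + (t ** (t ** (h ** h))) *+ 36
       + (t ** (h ** (h ** h))) *+ 2) *+ 24 + h ** (h ** (h ** h)).
  by apply: (unitize_inj (comN := comN)); rewrite !uE; ring.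
(* The cross terms above were written as multiples of 2, 6 and 24, so the inverse factorials cancel
   and integer coefficients remain. *)
have divn k (a b c : N) :
    k.+1%:R^-1 *: (a + b *+ k.+1 + c) = k.+1%:R^-1 *: a + b + k.+1%:R^-1 *: c.
  rewrite !scalerDr -scaler_nat scalerA mulVf ?scale1r //.
  by rewrite (iffLR (pcharf0P F) charF).
have sqr2 : 2%:R^-1 *: (h ** h + (t ** (h ** h)) *+ 12
    + (t ** (t ** (h ** h))) *+ 72 - z ** z) =
    2%:R^-1 *: (h ** h) + ((t ** (h ** h)) *+ 6 + (t ** (t ** (h ** h))) *+ 36)
    - 2%:R^-1 *: (z ** z).
  by rewrite -scalerN -divn (mulrnDl 2) -!mulrnA
    [X in _ = _ *: (X - _)]addrA.
have cub2 : 6%:R^-1 *: (h ** (h ** h) + (t ** (h ** (h ** h))) *+ 12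
    - z ** (z ** z)) =
    6%:R^-1 *: (h ** (h ** h)) + (t ** (h ** (h ** h))) *+ 2
    - 6%:R^-1 *: (z ** (z ** z)).
  by rewrite -scalerN -divn -!mulrnA.
rewrite quaE cubE sqrE sqr2 cub2 !divn.
set S := \sum_(_ <= _ < _) _.
apply: (unitize_inj (comN := comN)); rewrite ![in LHS](unitizeD, unitizeMn).
rewrite ![in RHS](unitizeD, unitizeN, unitizeMn).
by ring.
Qed.

End Identities.

(** * Representing a bilinear form through a nondegenerate one *)

Section Riesz.
Set Implicit Arguments.
Unset Strict Implicit.
Variables (F : fieldType) (V : vectType F).

(** Recording a functional by its values on a basis, b becomes an injective map from V to row
    vectors of the same dimension, hence invertible; w is its inverse composed with the map given by
    beta. *)
Lemma riesz_operator (b beta : V -> V -> F) :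
  (forall x, scalar (b x)) -> (forall y, scalar (b^~ y)) ->
  (forall x, scalar (beta x)) -> (forall y, scalar (beta^~ y)) ->
  (forall v, (forall x, b x v = 0) -> v = 0) ->
  exists w : 'End(V), forall x z, b x (w z) = beta x z.
Proof.
move=> linbr linbl lincr lincl b_nondeg.
pose e := vbasis {:V}.
pose coords (c : V -> V -> F) v := (\row_i c e`_i v : 'rV[F]_(\dim {:V})).
have coords_lin c : (forall x, scalar (c x)) -> linear (coords c).
  by move=> linc a x y; apply/rowP => i; rewrite !mxE linc.
have coords_inj (c d : V -> V -> F) v w :
    (forall y, scalar (c^~ y)) -> (forall y, scalar (d^~ y)) ->
    coords c v = coords d w -> forall x, c x v = d x w.
  move=> linc lind /rowP eq_cd x; rewrite (coord_vbasis (memvf x)) -/e.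
  pose cv := GRing.isLinear.Build F V F^o _ (c^~ v) (linc v).
  pose dw := GRing.isLinear.Build F V F^o _ (d^~ w) (lind w).
  pose fc : {linear V -> F^o} := HB.pack (c^~ v) cv.
  pose fd : {linear V -> F^o} := HB.pack (d^~ w) dw.
  rewrite -[LHS]/(fc _) -[RHS]/(fd _) !linear_sum; apply: eq_bigr => i _.
  have := eq_cd i; rewrite !mxE => eqi.
  by rewrite !linearZ /= eqi.
pose lb : {linear V -> 'rV_(\dim {:V})} :=
  HB.pack (coords b) (GRing.isLinear.Build F V _ _ _ (coords_lin b linbr)).
pose lc : {linear V -> 'rV_(\dim {:V})} :=
  HB.pack (coords beta)
    (GRing.isLinear.Build F V _ _ _ (coords_lin beta lincr)).
have ker0 : lker (linfun lb) = 0%VS.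
  apply/eqP/lker0P => v w; rewrite !lfunE => /coords_inj bvw.
  apply/eqP; rewrite -subr_eq0; apply/eqP/b_nondeg => x.
  have := linbr x (-1) w v; rewrite scaleN1r (addrC (- w)) => ->.
  by rewrite (bvw linbl linbl) mulN1r addNr.
have full : limg (linfun lb) = fullv.
  apply/eqP; rewrite eqEdim subvf /=.
  by rewrite (limg_dim_eq (_ : _ = 0%VS)) ?ker0 ?capv0 // !dimvf /dim /= mul1n.
exists ((linfun lb)^-1 \o linfun lc)%VF => x z.
apply: coords_inj => //.
have := limg_lfunVK (f := linfun lb) (x := linfun lc z).
by rewrite full memvf comp_lfunE => /(_ isT); rewrite !lfunE.
Qed.

End Riesz.

(** * The form p(x y) and the construction of the linear map L *)

Section Projection.
Set Implicit Arguments.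
Unset Strict Implicit.
Local Open Scope assoc_alg_scope.
Variables (F : fieldType) (N : assocAlgType F).
Hypothesis admN : admissible N.
Variables (p : 'End(N)) (Pi_p : is_Pi p).
Implicit Types (x y z : N).

Lemma Pi_mem x : p x \in nann N 1.
Proof. by case: Pi_p => _ <-; rewrite memv_img ?memvf. Qed.

Lemma Pi_id x : x \in nann N 1 -> p x = x.
Proof.
case: Pi_p => pp <- /memv_imgP[y _ ->].
by rewrite -[p (p y)]comp_lfunE pp.
Qed.

Lemma nann_sub j k : (0 < j <= k)%N -> (nann N j <= nann N k)%VS.
Proof.
case: j k => // j [|k] // le_jk; apply/subvP => x /memv_nann xN.
by apply/memv_nann => y /(subvP (npow_sub N (le_jk : j <= k)%N))/xN.
Qed.

(** Induction along the chain N_[1], N_[2], ..., which reaches N by nilpotency: each x a lies one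
    step lower and inherits the hypothesis, so it is in N_[1], where p is the identity, and x a =
    p(x a) = 0. *)
Lemma Pi_nondeg x : (forall y, p (x ** y) = 0) -> x \in nann N 1.
Proof.
have [_ [m m0] _] := admN.
have: x \in nann N m.+1.
  by apply/memv_nann => y; rewrite m0 memv0 => /eqP->; rewrite amulr0.
elim: m {m0} x => // m IHm x /memv_nann xN px0.
have xa a : x ** a \in nann N 1.
  apply: IHm => [|b]; last by rewrite -amulA.
  by apply/memv_nann => y my; rewrite -amulA xN // npowS memv_amul ?memvf.
by apply/memv_nann => a _; rewrite -(Pi_id (xa a)).
Qed.

(* The form (x, y) |-> p (x y) is degenerate along N_[1] only; adding
   p(x) p(y) makes it nondegenerate, and has no effect on functionals
   vanishing on N_[1]. *)
Lemma Pi_adjoint (Q : 'End(N)) : (forall x, x \in nann N 1 -> Q x = 0) ->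
  exists Q' : 'End(N), forall x z, p (x ** Q' z) = p (Q x ** z).
Proof.
have [comN _ dim1] := admN; move=> Q0.
pose e := vpick (nann N 1).
have e_nann : e \in nann N 1 by exact: memv_pick.
have e_neq0 : e != 0 by rewrite vpick0 -dimv_eq0 dim1.
have def_e : nann N 1 = <[e]>%VS.
  by apply/esym/eqP; rewrite eqEdim -memvE e_nann dim1 dim_vline e_neq0.
(* Since N_[1] is the line spanned by e, p amounts to a scalar functional f. *)
pose f x : F := coord [tuple e] ord0 (p x).
have pf x : p x = f x *: e.
  have := Pi_mem x; rewrite def_e -span_seq1 => /(@coord_span _ _ _ [tuple e]).
  by rewrite big_ord1.
have lin_f : scalar f by move=> a x y; rewrite /f !linearP.
have fe : f e = 1.
  apply/eqP; rewrite -subr_eq0 -[_ == 0]orbF -(negPf e_neq0) -scaler_eq0.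
  by rewrite scalerBl scale1r -pf Pi_id // subrr.
pose b x v := f (x ** v) + f x * f v.
have lin_b x : scalar (b x).
  move=> a v w; rewrite /b amulDr amulZr !lin_f; ring.
have bC x v : b x v = b v x by rewrite /b comN mulrC.
have b_nondeg v : (forall x, b x v = 0) -> v = 0.
  move=> bv0; have fv : f v = 0.
    have := bv0 e; rewrite /b nann1P // fe mul1r.
    by rewrite /f linear0 linear0 add0r.
  have v_nann : v \in nann N 1.
    apply: Pi_nondeg => y; rewrite pf; have := bv0 y.
    by rewrite /b fv mulr0 addr0 comN => ->; rewrite scale0r.
  by rewrite -(Pi_id v_nann) pf fv scale0r.
pose beta x z := f (Q x ** z).
have lin_bl v : scalar (b^~ v) by move=> a x y; rewrite !(bC _ v) lin_b.
have lin_beta x : scalar (beta x).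
  by move=> a v w; rewrite /beta amulDr amulZr lin_f.
have lin_betal z : scalar (beta^~ z).
  by move=> a x y; rewrite /beta linearP amulDl amulZl lin_f.
have [Q' Q'P] := riesz_operator lin_b lin_bl lin_beta lin_betal b_nondeg.
exists Q' => x z; rewrite !pf -[f (Q x ** z)]/(beta x z) -Q'P /b.
(* The added summand of b drops out: testing against e, where Q e = 0 and f e = 1, isolates f (Q'
   z). *)
suff -> : f (Q' z) = 0 by rewrite mulr0 addr0.
have := Q'P e z; rewrite /b /beta Q0 // amul0r nann1P // fe mul1r.
by rewrite /f !linear0 add0r.
Qed.

(** For c in N^2, every c b is again in N^2, so x c lies in N_[1] by nondegeneracy, and x c = p(x c)
    = 0. *)
Lemma Pi_nann2 x : {in npow N 2, forall c, p (x ** c) = 0} -> x \in nann N 2.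
Proof.
move=> px0; apply/memv_nann => c Nc.
have xc : x ** c \in nann N 1.
  apply: Pi_nondeg => b; rewrite -amulA px0 // npowS memv_amul ?memvf //.
by rewrite -(Pi_id xc) px0.
Qed.

Lemma nann_ideal k x a : x \in nann N k.+1 -> x ** a \in nann N k.+1.
Proof.
move=> /memv_nann xN; apply/memv_nann => y yk; rewrite -amulA xN //.
by rewrite (subvP (npow_subS N k)) // npowS memv_amul ?memvf.
Qed.

(** The kernel condition makes z |-> y + L z bijective; the condition on L z - z makes it preserve
    N_[4]. *)
Lemma Pi_exp1_absorb (charF : [pchar F] =i pred0) y :
  y \in nann N 4 -> p (exp1 y) = 0 ->
  exists L : 'End(N), [/\ lker L = 0%VS, forall z, L z - z \in nann N 4
    & forall z, p (exp1 (y + L z)) = p (exp1 z)].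
Proof.
have [comN nilN _] := admN.
have nat_neq0 n : (n.+1)%:R != 0 :> F by rewrite (iffLR (pcharf0P F) charF).
move=> y4 expy0; pose t := 12%:R^-1 *: y.
have y_def : y = t *+ 12.
  by rewrite -scaler_nat scalerA mulfV ?scale1r ?nat_neq0.
have t4 : t \in nann N 4 by rewrite memvZ.
(* Q must kill N^2 so that w takes values in N_[2], and N_[2] so that its adjoint exists and p(w z w
   z) = 0. *)
pose U := (npow N 2 + nann N 2)%VS.
have [Q QE] : exists Q : 'End(N), forall z, Q z = z - projv U z.
  by exists (\1%VF - projv U) => z; rewrite add_lfunE opp_lfunE id_lfunE.
have Q0 z : z \in U -> Q z = 0 by move=> Uz; rewrite QE projv_id // subrr.
have Q2 z : z \in nann N 2 -> Q z = 0.
  by move=> Nz; rewrite Q0 // (subvP (addvSr _ _)).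
have [z Nz|Q' Q'P] := @Pi_adjoint Q.
  by rewrite Q2 // (subvP (@nann_sub 1 2 isT)).
pose T := linfun (amul t).
have TE z : T z = t ** z by rewrite lfunE.
(* With this w, the term 2 p(z w z) cancels the terms with factor 4 in [correct_sqr]. *)
have [w wE] : exists w : 'End(N),
    forall z, w z = - Q' (t ** z + t ** (t ** Q z)) *+ 2.
  exists (2%:R *: - (Q' \o (T + (T \o (T \o Q))))%VF) => z.
  rewrite scale_lfunE scaler_nat opp_lfunE comp_lfunE add_lfunE.
  by rewrite !comp_lfunE !TE.
have pw x z : p (x ** w z) = - p (Q x ** (t ** z + t ** (t ** Q z))) *+ 2.
  rewrite wE -Q'P -[- Q' _ *+ 2]scaler_nat amulZr linearZ /= scaler_nat.
  by rewrite -scaleN1r amulZr linearZ /= scaleN1r.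
have w2 z : w z \in nann N 2.
  apply: Pi_nann2 => c Nc.
  by rewrite comN pw Q0 ?amul0r ?linear0 ?oppr0 ?mul0rn // (subvP (addvSl _ _)).
have pww z : p (w z ** w z) = 0.
  by rewrite pw Q2 ?amul0r ?linear0 ?oppr0 ?mul0rn.
(* The difference z - Q z is a + b with a in N^2 and b in N_[2]: t kills z z a, which lies in N^4,
   and b kills t z z. *)
have tzzQ z : t ** (z ** (z ** Q z)) = t ** (z ** (z ** z)).
  rewrite QE; have /memv_addP[a Na [b Nb ->]] := memv_proj U z.
  have amulN (c d : N) : c ** (- d) = - (c ** d) := linearN (amul c) d.
  have zero : t ** (z ** (z ** (a + b))) = 0.
    rewrite !amulDr; have /memv_nann -> := t4; last first.
      by rewrite !npowS !memv_amul ?memvf.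
    rewrite !amulA comN; move/memv_nann: Nb => -> //; first by rewrite addr0.
    by rewrite npowS memv_amul ?memvf.
  move: (a + b) zero => c zero.
  by rewrite !(amulDr, amulN) zero oppr0 addr0.
have [E EE] : exists E : 'End(N), forall z, E z = (t ** Q z) *+ 2 + w z.
  exists (2%:R *: (T \o Q)%VF + w) => z.
  by rewrite add_lfunE scale_lfunE scaler_nat comp_lfunE TE.
have [M ME] : exists M : 'End(N), forall z, M z = twist t (z + E z).
  have [G GE] : exists G : 'End(N), forall z, G z = z + E z.
    by exists (\1%VF + E) => z; rewrite add_lfunE id_lfunE.
  exists (G - 6%:R *: (T \o G)%VF + 18%:R *: (T \o (T \o G))%VF) => z.
  rewrite /twist -GE.
  by rewrite !add_lfunE opp_lfunE !scale_lfunE !scaler_nat !comp_lfunE !TE.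
(* W is multiplication by exp(y) = exp(12 t), up to the terms of degree >= 4
   in t, which annihilate N. *)
have [W WE] : exists W : 'End(N), forall z, W z = z + (t ** z) *+ 12
    + (t ** (t ** z)) *+ 72 + (t ** (t ** (t ** z))) *+ 288.
  exists (\1%VF + 12%:R *: T + 72%:R *: (T \o T)%VF
          + 288%:R *: (T \o (T \o T))%VF) => z.
  by rewrite !add_lfunE !scale_lfunE !scaler_nat !comp_lfunE id_lfunE !TE.
have W1 z : z \in nann N 1 -> W z = z.
  by move=> Nz; rewrite WE (comN t z) nann1P // !amulr0 !mul0rn !addr0.
(* S is the linear defect of M. Both W and p fix N_[1], so adding S restores p(W(L z)) = p(z). *)
have [L [S [LE SE]]] : exists (L S : 'End(N)),
    (forall z, L z = twist t (z + E z) + S z) /\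
    (forall z, S z = p (z - W (M z))).
  pose S : 'End(N) := (p \o (\1 - (W \o M)))%VF.
  exists (M + S), S; split=> z; first by rewrite add_lfunE ME.
  by rewrite comp_lfunE add_lfunE opp_lfunE comp_lfunE id_lfunE.
have S1 z : S z \in nann N 1 by rewrite SE Pi_mem.
have linL z : p (W (L z)) = p z.
  rewrite LE -ME linearD /= (W1 _ (S1 z)) linearD /= (Pi_id (S1 z)) SE.
  by rewrite linearB /= addrC subrK.
have sqrL z : let h := L z in
    p (h ** h + (t ** (h ** h)) *+ 12 + (t ** (t ** (h ** h))) *+ 72)
    = p (z ** z).
  rewrite /= LE (twist_sqr comN) // (correct_sqr comN _ (w2 z) (EE z)).
  rewrite 3!linearD /= pww addr0 !linearMn /= pw mulNrn mulNrn -mulrnA.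
  exact: addrK.
have cubL z : let h := L z in
    h ** (h ** h) + (t ** (h ** (h ** h))) *+ 12 = z ** (z ** z).
  rewrite /= LE (twist_cube comN) //.
  exact: (correct_cube comN t4 (w2 z) (EE z) (tzzQ z)).
have ge4L z m : apow (L z) m.+4 = apow z m.+4.
  by rewrite LE (twist_ge4 comN) // (correct_ge4 comN _ t4 (w2 z) (EE z)).
have lin0 z : p (W (L z) - z) = 0 by rewrite linearB /= linL subrr.
have sqr0 z : p (L z ** L z + (t ** (L z ** L z)) *+ 12
    + (t ** (t ** (L z ** L z))) *+ 72 - z ** z) = 0.
  by rewrite linearB /= sqrL subrr.
exists L; split=> [|z|z]; last first.
- rewrite y_def (exp1_shift charF comN nilN t4 (ge4L z)) -y_def -WE cubL subrr.
  rewrite scaler0 addr0 [LHS]linearD /= linearZ /= sqr0 scaler0 addr0.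
  by rewrite linearD /= lin0 addr0 linearD /= expy0 add0r.
- have sub14 := subvP (@nann_sub 1 4 isT).
  have sub24 := subvP (@nann_sub 2 4 isT).
  have tN a : t ** a \in nann N 4 by apply: nann_ideal.
  have -> : L z - z = E z - (t ** (z + E z)) *+ 6
      + (t ** (t ** (z + E z))) *+ 18 + S z.
    by rewrite LE /twist [LHS]addrC !addrA addNr add0r.
  rewrite EE; do ![apply: rpredD | rewrite rpredN | apply: rpredMn];
    by [apply: tN | apply: sub24 | apply: sub14].
(* If L z = 0, polarizing the quadratic identity gives p(z x) = 0 for all x, so z is in N_[1]; then
   z = p(z) = p(W(L z)) = 0. *)
apply/eqP; rewrite -subv0; apply/subvP => z; rewrite memv_ker memv0 => /eqP Lz0.
have z1 : z \in nann N 1.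
  have pzz : p (z ** z) = 0.
    by rewrite -sqrL Lz0 !amulr0 !mul0rn !addr0 linear0.
  apply: Pi_nondeg => x; have := sqrL (z + x).
  rewrite [L _]linearD /= Lz0 add0r sqrL !(amulDr, amulDl) (comN x z).
  rewrite !linearD /= pzz add0r addrA => /esym/eqP.
  rewrite -subr_eq0 addrK -mulr2n -scaler_nat scaler_eq0 (negPf (nat_neq0 _)).
  by move/eqP.
by rewrite -(Pi_id z1) -linL Lz0 !linear0.
Qed.
End Projection.

(** * Groups of affine bijections preserving a set *)

Section AffineGroup.
Set Implicit Arguments.
Unset Strict Implicit.
Local Open Scope classical_set_scope.
Variables (F : fieldType) (V : vectType F).
Implicit Types (S A : set V) (g h : V -> V).

Lemma image_bij_iff g A :
  bijective g -> (forall x, A (g x) <-> A x) -> g @` A = A.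
Proof.
move=> [h gK hK] gA; apply/seteqP; split=> [_ [x Ax <-] | x Ax].
  exact/gA.
by exists (h x); [apply/gA; rewrite hK | exact: hK].
Qed.

Lemma Aff_id S : Aff S id.
Proof.
split; last exact: image_id.
by split; [exists id | exists \1%VF, 0 => x; rewrite id_lfunE addr0].
Qed.

Lemma Aff_comp S g h : Aff S g -> Aff S h -> Aff S (g \o h).
Proof.
move=> [[bij_g [f [b gE]]] gS] [[bij_h [f' [b' hE]]] hS].
split; last by rewrite -image_comp hS gS.
split; first exact: bij_comp.
exists (f \o f')%VF, (f b' + b) => x /=.
by rewrite gE hE linearD comp_lfunE addrA.
Qed.

Lemma Aff_inv S g h : Aff S g -> cancel g h -> cancel h g -> Aff S h.
Proof.
move=> [[bij_g [f [b gE]]] gS] gK hK; split; last first.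
  apply/seteqP; split=> [_ [x + <-] | x Sx].
    by rewrite -{1}gS => -[y Sy <-]; rewrite gK.
  by exists (g x); rewrite ?gK // -gS; exists x.
split; first by exists g.
have f0 : lker f == 0%VS.
  apply/lker0P => x y eq_f; apply: (can_inj gK).
  by rewrite !gE eq_f.
exists (f^-1)%VF, (- (f^-1)%VF b) => x.
by rewrite -[x in RHS]hK gE linearD /= lker0_lfunK // addrK.
Qed.

(** Intersecting with [Aff A] ensures that A itself is preserved, as transitivity on A demands. *)
Lemma subgroup_AffI S A : subgroup_Aff S (Aff S `&` Aff A).
Proof.
split=> [g [] // | | g h [gS gA] [hS hA] | g [gS gA]].
- by split; apply: Aff_id.
- by split; apply: Aff_comp.
have [[[h gK hK] _] _] := gS.
exists h; split=> //; split; exact: (Aff_inv _ gK hK).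
Qed.

Lemma AffI_transitive S A x0 :
  (forall x, A x -> exists2 g, (Aff S `&` Aff A) g & g x0 = x) ->
  acts_transitively (Aff S `&` Aff A) A.
Proof.
move=> trA; split=> [g [_ []] // | x y /trA[g Hg <-] /trA[h Hh <-]].
have [_ _ HM HV] := subgroup_AffI S A; have [g' [Hg' gK _]] := HV g Hg.
by exists (h \o g'); [exact: HM | rewrite /= gK].
Qed.

End AffineGroup.

(** * Transitivity on the part of the hypersurface in N_[4] *)

Section Transitivity.
Set Implicit Arguments.
Unset Strict Implicit.
Local Open Scope classical_set_scope.
Variables (F : fieldType) (N : assocAlgType F).
Hypothesis charF : [pchar F] =i pred0.
Hypothesis admN : admissible N.

Lemma hypersurface_transitive (p : 'End(N)) : is_Pi p ->
  let S := hypersurface p in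
  let A := S `&` [set x | x \in nann N 4] in
  acts_transitively (Aff S `&` Aff A) A.
Proof.
move=> Pi_p S A; apply: (@AffI_transitive _ _ _ _ 0) => y [Sy y4].
have [L [L0 L4 Lexp]] := Pi_exp1_absorb admN Pi_p charF y4 Sy.
pose g x := L x + y.
have gS x : S (g x) <-> S x by rewrite /S /hypersurface /= /g addrC Lexp.
have gA x : A (g x) <-> A x.
  (* The displacement g x - x = (L x - x) + y lies in N_[4]. *)
  have gx4 : (g x \in nann N 4) = (x \in nann N 4).
    by rewrite -(subrK x (g x)) rpredDl // /g addrAC rpredD.
  by split=> -[/gS gx_S x4]; split=> //; move: x4; rewrite /= gx4.
have aff_g : affine_bijection g.
  split; last by exists L, y.
  exists (fun x => (L^-1)%VF (x - y)) => x; rewrite /g.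
    by rewrite addrK lker0_lfunK // L0.
  by rewrite lker0_lfunVK ?L0 // subrK.
exists g; last by rewrite /g linear0 add0r.
by split; split=> //; apply: image_bij_iff => //; case: aff_g.
Qed.

(** Nil-index k means N^(k+1) = 0, so x N^4 lies in N^5 = 0. *)
Lemma nil_index_nann k : is_nil_index N k -> (k <= 4)%N -> nann N 4 = fullv.
Proof.
move=> [Nk0 _] le_k4; apply/eqP; rewrite eqEsubv subvf; apply/subvP => x _.
apply/memv_nann => y y4.
have: amul x y \in npow N 5 by rewrite npowS memv_amul ?memvf.
by move/(subvP (npow_sub N le_k4)); rewrite Nk0 memv0 => /eqP.
Qed.

End Transitivity.

Local Open Scope classical_set_scope.

Theorem mainTheorem9 (F : fieldType) (charF : [pchar F] =i pred0)
    (N : assocAlgType F) (admN : admissible N) :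
  (forall p : 'End(N), is_Pi p ->
     exists H : set (N -> N),
       subgroup_Aff (hypersurface p) H /\
       acts_transitively H (hypersurface p `&` [set x | x \in nann N 4])) /\
  (forall k : nat, is_nil_index N k -> (k <= 4)%N -> property_AH N).
Proof.
split=> [p Pi_p | k Nk le_k4].
  exists (Aff (hypersurface p) `&`
          Aff (hypersurface p `&` [set x | x \in nann N 4])).
  split; first exact: subgroup_AffI.
  exact: hypersurface_transitive charF admN _ Pi_p.
have homog p : is_Pi p -> affinely_homogeneous (hypersurface (N := N) p).
  move=> Pi_p; have [_] := hypersurface_transitive charF admN Pi_p.
  rewrite (nil_index_nann Nk le_k4).
  rewrite (_ : [set x | _] = setT) ?setIT; last first.
    by apply/seteqP; split=> x //= _; rewrite memvf.
  move=> trS; split=> [g [] // | x y Sx Sy].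
  by have [g [gS _] gx] := trS x y Sx Sy; exists g.
(* The existential half of Property (AH) needs one concrete projection onto the annihilator. *)
split=> //; have Pi_proj : is_Pi (projv (nann N 1)).
  split; last exact: limg_proj.
  by apply/lfunP => x; rewrite comp_lfunE projv_proj.
by exists (projv (nann N 1)); last exact: homog.
Qed.
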